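(* Let $m,n,s$ be integers with $m,n$ positive, $s\ge 3$ and $\binom{s}{2}-s\le m-n\le\binom{n}{2}-n$. Let $G$ be a graph in $\mathscr{G}_{m,n}$ having the maximum number of $s$-cliques among all graphs in $\mathscr{G}_{m,n}$. (i) If $t_{m,n}\le s-2$, then $G^{s-2}\cong K_{r_{m,n}}$. (ii) If $t_{m,n}\ge s-1$, then either $G^{s-2}\cong K_{r_{m,n}}^{t_{m,n}}$, or else $s=3$, $t_{m,n}=2$, $r_{m,n}\ge 3$ and $G^{s-2}\in\mathbb{B}(r_{m,n},3)$ (up to isomorphism).
   Context: Graphs are undirected, finite and simple. $\mathscr{G}_{m,n}$ is the set of connected graphs with $m$ edges and $n$ vertices. An $s$-clique of $G$ is a complete subgraph of $G$ on $s$ vertices. $K_p$ and $C_q$ denote the complete graph on $p$ vertices and the cycle on $q$ vertices. For a graph $G$ and a positive integer $j$, $G^{j}$ denotes the graph obtained from $G$ by iteratively removing vertices of degree at most $j$ (degree in the current graph) until the resulting graph has minimum degree at least $j+1$ or is empty (has no vertices). It does not depend on the order of vertex deletions. For positive integers $m,n$ with $n-1\le m\le\binom n2$, the positive integers $r_{m,n}$ and $t_{m,n}$ are defined by $$m-n=\binom{r_{m,n}-1}{2}+t_{m,n}-2,$$ where $2\le t_{m,n}\le r_{m,n}$ if $m-n\ge 0$, and $t_{m,n}=r_{m,n}=1$ if $m-n=-1$ (this determines them uniquely). For $0\le t\le r$, $K_r^t$ is the graph obtained from $K_r$ by adding one new vertex and joining it to exactly $t$ vertices of $K_r$. $\mathbb{B}(p,q)$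 is the set of graphs obtained from disjoint copies of $K_p$ and $C_q$ by adding a path of some length $\ell\ge 0$ between one vertex of $K_p$ and one vertex of $C_q$ (internal vertices of the path are new; $\ell=0$ means that the two vertices are identified). *)

(* Defs.v *)
From HB Require Import structures.
From mathcomp Require Import all_boot all_order all_algebra.

Set Implicit Arguments.
Unset Strict Implicit.
Unset Printing Implicit Defensive.

Import Order.TTheory GRing.Theory Num.Theory.

Record sgraph := SGraph {
  vertex :> finType;
  adj : rel vertex;
  adj_sym : symmetric adj;
  adj_irr : irreflexive adj }.

Section FromRel.
Variables (T : finType) (e : rel T).

Definition sym_rel : rel T := fun x y => (x != y) && (e x y || e y x).

Lemma sym_rel_sym : symmetric sym_rel.
Proof. by move=> x y; rewrite /sym_rel eq_sym orbC. Qed.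

Lemma sym_rel_irr : irreflexive sym_rel.
Proof. by move=> x; rewrite /sym_rel eqxx. Qed.

Definition from_rel : sgraph := SGraph sym_rel_sym sym_rel_irr.
End FromRel.

Section Induced.
Variables (G : sgraph) (A : {set G}).

Definition induced_adj : rel {x | x \in A} := fun x y => adj (val x) (val y).

Lemma induced_sym : symmetric induced_adj.
Proof. by move=> x y; apply: adj_sym. Qed.

Lemma induced_irr : irreflexive induced_adj.
Proof. by move=> x; apply: adj_irr. Qed.

Definition induced : sgraph := SGraph induced_sym induced_irr.
End Induced.

Definition iso (G H : sgraph) : Prop :=
  exists2 f : G -> H, bijective f & {mono f : x y / adj x y}.

Definition edges (G : sgraph) : {set {set G}} :=
  [set [set p.1; p.2] | p : G * G & adj p.1 p.2].

(* The empty graph satisfies this, but it is excluded wherever n > 0. *)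
Definition connected (G : sgraph) : Prop :=
  forall x y : G, connect (@adj G) x y.

Definition in_Gmn (m n : nat) (G : sgraph) : Prop :=
  [/\ connected G, #|edges G| = m & #|G| = n].

Definition clique (G : sgraph) (A : {set G}) : bool :=
  [forall x in A, forall y in A, (x != y) ==> adj x y].

Definition ncliques (s : nat) (G : sgraph) : nat :=
  #|[set A : {set G} | clique A & #|A| == s]|.

Definition deg_in (G : sgraph) (A : {set G}) (v : G) : nat :=
  #|[set w in A | adj v w]|.

Definition peel (G : sgraph) (j : nat) (A : {set G}) : {set G} :=
  if [pick v in A | deg_in A v <= j] is Some v then A :\ v else A.

(* #|G| rounds suffice: a round that deletes no vertex leaves the set fixed. *)
Definition core_set (G : sgraph) (j : nat) : {set G} :=
  iter #|G| (peel j) [set: G].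

(* The graph G^j. *)
Definition core (G : sgraph) (j : nat) : sgraph := induced (core_set G j).

(* Independence of the deletion order: core_set G j has minimum degree > j and
   contains every vertex set with that property. *)
Lemma core_set_deg (G : sgraph) (j : nat) (v : G) :
  v \in core_set G j -> j < deg_in (core_set G j) v.
Proof.
have H k : #|iter k (@peel G j) [set: G]| <= #|G| - k \/
  forall v, v \in iter k (@peel G j) [set: G] ->
    j < deg_in (iter k (@peel G j) [set: G]) v.
  elim: k => [|k IH]; first by left; rewrite subn0 max_card.
  rewrite iterS; move: (iter k _ _) IH => A IH; rewrite /peel.
  case: pickP => [w /andP[wA dw]|none].
    left; case: IH => [leA|dA]; last by move: (dA w wA); rewrite ltnNge dw.
    by move: leA; rewrite (cardsD1 w A) wA subnS; case: (_ - _).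
  right=> w wA; rewrite ltnNge; apply/negP=> dw.
  by move: (none w); rewrite wA dw.
case: (H #|G|) => [|dA]; last exact: dA.
by rewrite subnn leqn0 cards_eq0 /core_set => /eqP ->; rewrite inE.
Qed.

Lemma core_set_max (G : sgraph) (j : nat) (B : {set G}) :
  (forall v, v \in B -> j < deg_in B v) -> B \subset core_set G j.
Proof.
move=> dB; rewrite /core_set; elim: #|G| => [|k IH]; first exact: subsetT.
rewrite iterS; move: (iter k _ _) IH => A BA; rewrite /peel.
case: pickP => // w /andP[wA dw]; apply/subsetD1P; split=> //.
apply/negP=> /dB; rewrite ltnNge => /negP; apply; apply: leq_trans dw.
by apply/subset_leq_card/subsetP=> x; rewrite !inE => /andP[/(subsetP BA)-> ->].
Qed.

(* r and t are the parameters r_{m,n} and t_{m,n}. *)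
Definition rt_params (m n r t : nat) : Prop :=
  [/\ 0 < r, 0 < t,
      (m%:Z - n%:Z = 'C(r.-1, 2)%:Z + t%:Z - 2)%R
    & ((0 <= m%:Z - n%:Z)%R /\ 2 <= t <= r) \/
      ((m%:Z - n%:Z = -1)%R /\ (t = 1 /\ r = 1))].

Definition complete (r : nat) : sgraph := from_rel (fun _ _ : 'I_r => true).

(* K_r^t for t <= r: None is the added vertex, joined to 0, ..., t - 1. *)
Definition complete_plus (r t : nat) : sgraph :=
  from_rel (fun x y : option 'I_r =>
    match x, y with
    | Some _, Some _ => true
    | None, Some i => i < t
    | _, _ => false
    end).

(* For p >= 1 and q >= 3, with b = p - 1 + l: K_p is on 0, ..., p - 1, the path
   of length l is p - 1, ..., b, and C_q is on b, ..., b + q - 1.  The end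
   vertices p - 1 of K_p and b of C_q are no restriction up to isomorphism, as
   K_p and C_q are vertex-transitive; for l = 0 they coincide. *)
Definition clique_path_cycle (p l q : nat) : sgraph :=
  let b := p.-1 + l in
  from_rel (fun x y : 'I_(b + q) =>
    [|| (x < p) && (y < p),
        (p.-1 <= x < b) && (y == x.+1 :> nat)
      | [&& b <= x, b <= y & y - b == (x - b).+1 %% q]]).

Definition in_B (p q : nat) (H : sgraph) : Prop :=
  exists l : nat, iso H (clique_path_cycle p l q).

(* Main.v *)
Require Import Defs.
From mathcomp Require Import all_boot all_order all_algebra.
From mathcomp Require Import zify.

Set Implicit Arguments.
Unset Strict Implicit.
Unset Printing Implicit Defensive.

(* Put s = k + 1 and x = m - n + 1 = C(r - 1, 2) + (t - 1).  Order the vertices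
   of a connected graph so that every vertex but the first has an earlier
   neighbour, and let T be the spanning tree joining each vertex to its earliest
   neighbour.  The tree edges inside a clique S form a star centred at the first
   vertex a of S; if there are any, S \ a is a clique of G - T that determines
   a.  Hence the (k+1)-cliques of G are at most the (k+1)-cliques plus the
   k-cliques of G - T, a graph with x edges.  A Kruskal-Katona type induction
   bounds this sum by C(r, k + 1) + C(t, k), and in the case of equality G - T
   contains a clique on r - 1 vertices, which extends to an r-clique R of G
   (r >= s; if r = s - 1 then R comes from a single s-clique).  Finally G is
   grown vertex by vertex from R: by convexity one vertex must absorb the whole
   remaining excess t - 1, and it is attached to R, or else it closes a triangle
   elsewhere. *)

(** * Counting cliques *)

Definition nbh (G : sgraph) (A : {set G}) (v : G) : {set G} :=
  [set w in A | adj v w].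

Definition kcliques (G : sgraph) (k : nat) (A : {set G}) : {set {set G}} :=
  [set S : {set G} | [&& S \subset A, clique S & #|S| == k]].

Definition kcl (G : sgraph) (k : nat) (A : {set G}) : nat := #|kcliques k A|.

Section Cliques.
Variable G : sgraph.
Implicit Types (A B S : {set G}) (v : G).

Lemma cliqueP A : reflect {in A &, forall x y, x != y -> adj x y} (clique A).
Proof.
apply: (iffP forall_inP) => [cA x y xA yA xy|cA x xA].
  by move/forall_inP: (cA x xA) => /(_ y yA)/implyP; apply.
by apply/forall_inP=> y yA; apply/implyP; apply: cA.
Qed.

Lemma sub_clique A B : B \subset A -> clique A -> clique B.
Proof.
move=> /subsetP BA /cliqueP cA; apply/cliqueP=> x y /BA xA /BA yA.
exact: cA.
Qed.

Lemma clique_setU1 A v : A \subset nbh setT v -> clique A -> clique (v |: A).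
Proof.
move=> /subsetP Av /cliqueP cA; apply/cliqueP=> x y; rewrite !inE.
have {}Av z : z \in A -> adj v z by move/Av; rewrite !inE.
case/predU1P=> [->|xA] /predU1P[->|yA]; rewrite ?eqxx //.
- by move=> _; apply: Av.
- by move=> _; rewrite adj_sym; apply: Av.
- exact: cA.
Qed.

Lemma nbh_notin A v : v \notin nbh A v.
Proof. by rewrite inE adj_irr andbF. Qed.

Lemma nbh_sub A v : nbh A v \subset A.
Proof. by apply/subsetP=> x; rewrite inE => /andP[]. Qed.

Lemma nbhS A B v : A \subset B -> nbh A v \subset nbh B v.
Proof.
by move=> /subsetP AB; apply/subsetP=> x; rewrite !inE => /andP[/AB -> ->].
Qed.

Lemma nbhU1 A v : nbh (v |: A) v = nbh A v.
Proof. by apply/setP=> x; rewrite !inE; case: eqP => // ->; rewrite adj_irr !andbF. Qed.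

(** Cliques are split by whether they contain [v]; those that do correspond to [k]-cliques in the
    neighbourhood of [v]. This Pascal-type rule drives the vertex-by-vertex inductions below. *)
Lemma kclU1 k A v :
  v \notin A -> kcl k.+1 (v |: A) = kcl k.+1 A + kcl k (nbh A v).
Proof.
move=> vA; rewrite /kcl -(cardsID [set S : {set G} | v \in S]) addnC.
congr (_ + _).
  apply: eq_card => S; rewrite !inE.
  have [vS|vS] /= := boolP (v \in S).
    apply/esym/negbTE; apply/negP=> /and3P[/subsetP/(_ v vS)].
    by rewrite (negbTE vA).
  by rewrite -[in RHS](setU1K vA) subsetD1 vS andbT.
rewrite -[RHS](@card_in_imset _ _ (fun S : {set G} => v |: S)); last first.
  move=> S S' /[!inE] /andP[/subsetP sS _] /andP[/subsetP sS' _] E.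
  have nS : v \notin S by apply/negP=> /sS; rewrite inE adj_irr andbF.
  have nS' : v \notin S' by apply/negP=> /sS'; rewrite inE adj_irr andbF.
  by rewrite -(setU1K nS) E setU1K.
apply: eq_card => S; rewrite !inE; apply/idP/imsetP.
  case/andP=> /and3P[sS cS szS] vS; exists (S :\ v); last by rewrite setD1K.
  rewrite inE (sub_clique (subsetDl S _) cS) /=.
  move: szS; rewrite (cardsD1 v S) vS /= eqSS => ->; rewrite andbT.
  apply/subsetP=> x; rewrite !inE => /andP[xv xS].
  move/subsetP/(_ x xS): sS; rewrite !inE (negbTE xv) /= => -> /=.
  by move/cliqueP: cS; apply=> //; rewrite eq_sym.
case=> S'; rewrite inE => /and3P[sS cS szS] ->.
have nS : v \notin S' by apply: contra (nbh_notin A v); apply: (subsetP sS).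
rewrite setU11 andbT cardsU1 nS add1n eqSS szS andbT.
rewrite setUS ?(subset_trans sS) ?nbh_sub //=.
by apply: clique_setU1 => //; apply: (subset_trans sS (nbhS _ (subsetT A))).
Qed.

Lemma kclD1 k A v :
  v \in A -> kcl k.+1 A = kcl k.+1 (A :\ v) + kcl k (nbh A v).
Proof.
move=> vA; rewrite -{1}(setD1K vA) kclU1 ?setD11 //; congr (_ + kcl _ _).
by rewrite -[in RHS](setD1K vA) nbhU1.
Qed.

Lemma kcl1 A : kcl 1 A = #|A|.
Proof.
rewrite -[RHS](card_imset _ (@set1_inj G)); apply: eq_card => S; rewrite !inE.
apply/and3P/imsetP => [[sS _ /cards1P[x E]]|[x xA ->]].
  by exists x => //; apply: (subsetP sS); rewrite E set11.
rewrite sub1set xA cards1; split=> //; apply/cliqueP=> y z.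
by rewrite !inE => /eqP-> /eqP->; rewrite eqxx.
Qed.

Lemma kcl_le_bin k A : kcl k A <= 'C(#|A|, k).
Proof.
rewrite -(cards_draws A k); apply/subset_leq_card/subsetP=> S.
by rewrite !inE => /and3P[-> _ ->].
Qed.

Lemma kcl_clique k A : clique A -> kcl k A = 'C(#|A|, k).
Proof.
move=> cA; rewrite -(cards_draws A k); apply: eq_card => S; rewrite !inE.
by case: (boolP (S \subset A)) => //= sA; rewrite (sub_clique sA cA).
Qed.

Lemma kcl_set0 k : kcl k.+1 (set0 : {set G}) = 0.
Proof. by apply/eqP; rewrite -leqn0 (leq_trans (kcl_le_bin _ _)) // cards0. Qed.

Lemma kclS k A B : A \subset B -> kcl k A <= kcl k B.
Proof.
move=> AB; apply/subset_leq_card/subsetP=> S; rewrite !inE.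
by case/and3P=> [SA -> ->]; rewrite (subset_trans SA AB).
Qed.

Lemma exists_subset_between k B A : B \subset A -> #|B| <= k <= #|A| ->
  exists S : {set G}, [/\ B \subset S, S \subset A & #|S| = k].
Proof.
move=> BA /andP[Bk kA]; elim: k Bk kA => [|k IH] Bk kA.
  by exists B; split=> //; apply/eqP; rewrite -leqn0.
move: Bk; rewrite leq_eqVlt => /predU1P[<-|Bk]; first by exists B.
have [S [BS SA Sk]] := IH Bk (ltnW kA).
have /subsetPn[v vA vS] : ~~ (A \subset S).
  by apply/negP=> /subset_leq_card; rewrite Sk leqNgt kA.
exists (v |: S); rewrite cardsU1 vS Sk; split=> //.
  exact: subset_trans BS (subsetUr _ _).
by rewrite subUset sub1set vA.
Qed.

(** Attaining the bound makes every [k]-subset of [A] a clique, and any two vertices of [A] lie in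
    such a subset. *)
Lemma kcl_eq_bin k A : 2 <= k <= #|A| -> 'C(#|A|, k) <= kcl k A -> clique A.
Proof.
case/andP=> k2 kA le; apply/cliqueP=> x y xA yA xy.
have sBA : [set x; y] \subset A by apply/subsetP=> z /set2P[]->.
have [|S [BS SA Sk]] := exists_subset_between (k := k) sBA.
  by rewrite cards2 xy k2.
have sK : kcliques k A \subset [set B : {set G} | B \subset A & #|B| == k].
  by apply/subsetP=> B; rewrite !inE => /and3P[-> _ ->].
have : S \in kcliques k A.
  suff -> : kcliques k A = [set B : {set G} | B \subset A & #|B| == k].
    by rewrite inE SA Sk eqxx.
  by apply/eqP; rewrite eqEcard sK cards_draws.
rewrite inE => /and3P[_ /cliqueP cS _].
by apply: cS => //; apply: (subsetP BS); rewrite !inE eqxx ?orbT.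
Qed.

(** By Pascal's rule both summands attain their binomial bounds. Whichever of the sizes [k] and
    [k.-1] lies between 2 and [#|A|] then shows completeness; if neither does, [A] has at most one
    vertex. *)
Lemma kcl_eq_bin2 k A : 2 <= k <= #|A|.+1 ->
  'C(#|A|.+1, k) <= kcl k A + kcl k.-1 A -> clique A.
Proof.
case/andP=> k2; case: k k2 => // k k1 kA; rewrite binS /= => le.
have le1 := kcl_le_bin k.+1 A; have le2 := kcl_le_bin k A.
have [ltkA|geAk] := ltnP k #|A|.
  by apply: (@kcl_eq_bin k.+1); rewrite ?ltkA //; lia.
have [k2|k1'] := ltnP 1 k; first by apply: (@kcl_eq_bin k); rewrite ?k2 //; lia.
have : #|A| <= 1 by lia.
move/card_le1_eqP=> A1; apply/cliqueP=> x y xA yA.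
by rewrite (A1 x y) ?eqxx.
Qed.

(** Deleting a vertex lowers the other degrees by at most one, so successive deletions destroy at
    least [d], [d - 1], ..., 1 edges. *)
Lemma min_deg_edges d A :
  A != set0 -> {in A, forall v, d <= #|nbh A v|} -> 'C(d.+1, 2) <= kcl 2 A.
Proof.
elim: d A => [|d IH] A A0 dA; first by rewrite bin_small.
have [v vA] := set0Pn _ A0.
have dv := dA v vA.
rewrite (kclD1 1 vA) kcl1 binS bin1 leq_add //.
apply: IH => [|w].
  have /card_gt0P[w] : 0 < #|nbh A v| by apply: leq_trans dv.
  rewrite inE => /andP[wA vw]; apply/set0Pn; exists w; rewrite !inE wA andbT.
  by apply/eqP=> E; rewrite E adj_irr in vw.
rewrite !inE => /andP[wv wA]; rewrite -ltnS (leq_trans (dA w wA)) //.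
rewrite (cardsD1 v) -add1n leq_add ?leq_b1 //.
by apply/subset_leq_card/subsetP=> x; rewrite !inE => /and3P[-> -> ->].
Qed.
End Cliques.

Lemma clique_set2 (G : sgraph) (x y : G) : x != y -> clique [set x; y] = adj x y.
Proof.
move=> xy; apply/cliqueP/idP => [|axy u v].
  by apply; rewrite ?inE ?eqxx ?orbT.
by move=> /set2P[->|->] /set2P[->|->]; rewrite ?eqxx // adj_sym.
Qed.

Lemma kcl2U1 (G : sgraph) (A : {set G}) v :
  v \notin A -> kcl 2 (v |: A) = kcl 2 A + #|nbh A v|.
Proof. by move=> vA; rewrite kclU1 // kcl1. Qed.

(** * Cliques and number of edges *)

Lemma ltn_bin2l m n k : 0 < k <= n -> m < n -> 'C(m, k) < 'C(n, k).
Proof.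
case: n => // n; case: k => // k /andP[_ kn] mn.
by rewrite binS -addn1 leq_add ?bin_gt0 // leq_bin2l.
Qed.

(** Discrete convexity: a unit step of the upper argument gains a binomial with [k] lowered by one,
    which is monotone. *)
Lemma bin_exchange k a d i :
  d <= a -> 'C(d + i, k) + 'C(a, k) <= 'C(a + i, k) + 'C(d, k).
Proof.
move=> da; elim: i => [|i IH]; first by rewrite !addn0 addnC.
rewrite !addnS; case: k IH => [|k] IH; first by rewrite !bin0.
rewrite !binS; have := @leq_bin2l (d + i) (a + i) k; lia.
Qed.

(** Strictness comes from the last unit step alone; [k <= a + i] keeps the larger gain of that step
    positive. *)
Lemma bin_exchange_lt k a d i : 1 < k <= a + i -> 0 < i -> d < a ->
  'C(d + i, k) + 'C(a, k) < 'C(a + i, k) + 'C(d, k).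
Proof.
case: k i => // k [|i] // /andP[k1 ka] _ da.
have := bin_exchange k.+1 i (ltnW da); rewrite !addnS !binS.
have : 'C(d + i, k) < 'C(a + i, k) by apply: ltn_bin2l; lia.
lia.
Qed.

Section EdgeBound.
Variable (G : sgraph) (k : nat).
Hypothesis k_gt1 : 1 < k.
Implicit Types A Q : {set G}.

Let weight A := kcl k.+1 A + kcl k A.

Lemma link_le A : kcl k A + kcl k.-1 A <= 'C(#|A|.+1, k).
Proof. by case: k k_gt1 => // k' _; rewrite binS leq_add ?kcl_le_bin. Qed.

Lemma weightD1 A v : v \in A ->
  weight A = weight (A :\ v) + (kcl k (nbh A v) + kcl k.-1 (nbh A v)).
Proof.
move=> vA; rewrite /weight (kclD1 k vA).
by case: k k_gt1 => // k' _; rewrite (kclD1 k' vA) addnACA.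
Qed.

(* Delete a vertex of minimum degree.  Each of the two counts alone is not
   rigid ([kcl 2] is just the number of edges, and [kcl k.+1] may vanish), but
   equality in the bound for their sum forces a large clique. *)
Lemma weight_edges A rho tau :
  tau <= rho -> kcl 2 A = 'C(rho, 2) + tau ->
  weight A <= 'C(rho.+1, k.+1) + 'C(tau.+1, k) /\
  (k <= rho -> 'C(rho.+1, k.+1) + 'C(tau.+1, k) <= weight A ->
   exists Q : {set G}, [/\ Q \subset A, clique Q & #|Q| = rho]).
Proof.
have [N] := ubnP #|A|; elim: N A rho tau => // N IH A rho tau szA tr e2.
have [A0|[v0 v0A]] := set_0Vmem A.
  have k0 : kcl k (set0 : {set G}) = 0 by case: k k_gt1 => // k' _; rewrite kcl_set0.
  move: e2; rewrite A0 /weight !kcl_set0 k0 => e2; split=> // kr.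
  have : 0 < 'C(rho, 2) by rewrite bin_gt0 (leq_trans k_gt1).
  lia.
case: (arg_minnP (fun v => #|nbh A v|) v0A) => v.
rewrite -[_ v]/(v \in A) => vA dmin.
set d := #|nbh A v| in dmin.
have A_neq0 : A != set0 by apply/set0Pn; exists v.
have d2 : 'C(d.+1, 2) <= 'C(rho, 2) + tau.
  by rewrite -e2; apply: min_deg_edges => // w /dmin.
have e2v := kclD1 1 vA; rewrite kcl1 -/d in e2v.
have szv : #|A :\ v| < N by move: szA; rewrite (cardsD1 v A) vA.
have Wv := weightD1 vA.
have link := link_le (nbh A v); rewrite -/d in link.
have C1 : 'C(1, k) = 0 by rewrite bin_small.
(* If [d <= tau], the deletion uses up part of the remainder [tau]. Otherwise it lowers [rho] by one
   and leaves the remainder [rho + tau - d] in terms of the new [rho]. *)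
have [dt|td] := leqP d tau.
  have [||Wle Weq] := IH (A :\ v) rho (tau - d) szv; [lia|lia|].
  have := @bin_exchange k (tau - d).+1 1 d isT.
  rewrite C1 addn0 add1n addSn subnK //.
  split=> [|kr le]; first lia.
  have [||Q [QA cQ sQ]] := Weq _ _; [done|lia|].
  by exists Q; split=> //; apply: subset_trans QA (subsetDl _ _).
have dr : d < rho.
  rewrite ltnNge; apply/negP=> rd.
  by move: d2 (leq_bin2l 2 rd); rewrite binS bin1; lia.
case: rho => [|rho] // in tr e2 d2 dr *.
have [||Wle Weq] := IH (A :\ v) rho (rho + tau - d) szv; [lia| |].
  move: e2; rewrite binS bin1; lia.
have E1 : (rho + tau - d).+1 = tau.+1 + (rho - d) by lia.
have E2 : rho.+1 = d.+1 + (rho - d) by lia.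
have ex := @bin_exchange k d.+1 tau.+1 (rho - d) (ltnW td).
rewrite E1 in Wle; rewrite -E2 in ex; split=> [|kr le].
  by rewrite (binS rho.+1); lia.
(* [rho] is now one below its original value, so a neighbourhood of [rho] vertices together with [v]
   has the required size. A smaller [d] would make the exchange inequality strict. *)
have ed : d = rho.
  apply/eqP; rewrite eqn_leq -ltnS dr leqNgt; apply/negP=> dr'.
  have := @bin_exchange_lt k d.+1 tau.+1 (rho - d).
  rewrite -E2 k_gt1 kr subn_gt0 dr' => /(_ isT isT td).
  move: le; rewrite (binS rho.+1); lia.
have cN : clique (nbh A v).
  apply: (kcl_eq_bin2 (k := k)); rewrite -/d ed ?k_gt1 //.
  move: Wle le; rewrite (binS rho.+1) ed subnn addn0; lia.
exists (v |: nbh A v); split.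
- by rewrite subUset sub1set vA nbh_sub.
- by apply: clique_setU1; rewrite ?nbhS.
- by rewrite cardsU1 nbh_notin -/d ed.
Qed.
End EdgeBound.

(** * Growing a vertex set in a connected graph *)

Section Growth.
Variable G : sgraph.
Hypothesis G_conn : connected G.
Implicit Types A B W R : {set G}.

(** A proper subset containing [A0] always has an outside vertex with a neighbour inside; otherwise
    it would be closed under adjacency, against connectedness. *)
Lemma growth (P : {set G} -> Prop) A0 : A0 != set0 -> P A0 ->
  (forall A v, A0 \subset A -> v \notin A -> 0 < #|nbh A v| -> P A ->
    P (v |: A)) ->
  P setT.
Proof.
move=> A0_neq0 PA0 step.
suff ext N A : #|~: A| < N -> A0 \subset A -> P A -> P setT.
  exact: ext (ltnSn _) (subxx A0) PA0.
elim: N A => // N IH A ltN A0A PA.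
have [<-//|AT] := eqVneq A setT.
have [v vA] : exists v, v \in ~: A.
  by apply/set0Pn; apply: contraNneq AT => E; rewrite -(setCK A) E setC0.
have [u uA0] := set0Pn _ A0_neq0; have uA := subsetP A0A u uA0.
have [/existsP[w /andP[wA wN]]|] :=
  boolP [exists w, (w \notin A) && (0 < #|nbh A w|)].
  apply: (IH (w |: A)); last exact: step.
    rewrite -ltnS (leq_trans _ ltN) // ltnS setCU setIC -setDE.
    by rewrite (cardsD1 w (~: A)) inE wA.
  exact: subset_trans A0A (subsetUr _ _).
rewrite negb_exists => /forallP no.
have clA : closed (@adj G) A.
  apply: intro_closed => [|x y xy xA]; first exact/sym_connect_sym/adj_sym.
  apply/negPn/negP=> yA; move: (no y); rewrite yA /= lt0n negbK cards_eq0.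
  by move/eqP/setP/(_ x); rewrite !inE xA adj_sym xy.
by move: vA; rewrite inE -(closed_connect clA (G_conn u v)) uA.
Qed.

Lemma growth_edges A0 : A0 != set0 -> kcl 2 A0 + #|G| <= kcl 2 [set: G] + #|A0|.
Proof.
move=> A0_neq0; rewrite -cardsT; apply: (growth (P := fun A => kcl 2 A0 + #|A| <= kcl 2 A + #|A0|) A0_neq0) => //.
move=> A v _ vA d /=.
rewrite kclU1 // kcl1 cardsU1 vA; lia.
Qed.

(* While growing [W] to the whole graph, a new vertex sees at most [y.+1]
   vertices of the set built so far. *)
Lemma growth_core W B y : W != set0 ->
  kcl 2 [set: G] + #|W| <= kcl 2 W + #|G| + y ->
  {in B, forall v, y.+2 <= #|nbh B v|} -> B \subset W.
Proof.
move=> W_neq0 le; rewrite -cardsT in le.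
pose P A := kcl 2 W + #|A| <= kcl 2 A + #|W| /\
  (kcl 2 A + #|W| <= kcl 2 W + #|A| + y -> forall B : {set G},
   B \subset A -> {in B, forall v, y.+2 <= #|nbh B v|} -> B \subset W).
suff [_ PT] : P setT by move=> dB; apply: PT => //; apply: subsetT.
apply: (growth (P := P) W_neq0) => [|A v WA vA d [Pge Ple]]; first by split.
rewrite /P kclU1 // kcl1 cardsU1 vA; split=> [|leA C CA dC]; first lia.
apply: Ple => //; first lia.
(* If [C] contained the new vertex [v], then [v] would have at least [y.+2] neighbours in [A], more
   than the edge bound on [v |: A] allows. *)
apply/subsetP=> x xC; have /setU1P[E|//] := subsetP CA x xC.
have := dC x xC; rewrite E in xC *.
have : #|nbh C v| <= #|nbh A v|.
  by rewrite -(nbhU1 A); apply/subset_leq_card/nbhS.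
lia.
Qed.
End Growth.

(** * Deleting a spanning tree *)

(** The set is grown from the root, and each new vertex is ranked above everything reached before
    it. *)
Lemma search_order (G : sgraph) (root : G) : connected G ->
  exists rk : G -> nat, [/\ injective rk, rk root = 0 &
    forall v, v != root -> exists2 u, adj v u & rk u < rk v].
Proof.
move=> G_conn.
pose P (A : {set G}) := exists rk : G -> nat,
  [/\ {in A &, injective rk}, rk root = 0 & {in A, forall v, v != root ->
    exists u, [/\ u \in A, adj v u & rk u < rk v]}].
suff [rk [inj rk0 par]] : P setT.
  exists rk; split=> // [x y /inj|v /par]; first by rewrite !inE; apply.
  by case=> [|u [_]]; rewrite ?inE //; exists u.
have r1 : [set root] != set0 by apply/set0Pn; exists root; rewrite set11.
apply: (growth G_conn r1) => [|A v rA vA d [rk [inj rk0 par]]].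
  exists (fun=> 0); split=> // x; first by move=> y /set1P-> /set1P->.
  by move/set1P->; rewrite eqxx.
have vr : root != v by apply: contraNneq vA => <-; rewrite -sub1set.
pose M := (\max_(u in A) rk u).+1.
have rkM x : x \in A -> rk x < M by move=> xA; rewrite ltnS leq_bigmax_cond.
exists (fun x => if x == v then M else rk x); split.
- move=> x y /setU1P[->|xA] /setU1P[->|yA] //; rewrite ?eqxx.
  + case: eqP => [->//|_ E]; by have := rkM y yA; rewrite -E ltnn.
  + case: eqP => [->//|_ E]; by have := rkM x xA; rewrite E ltnn.
  + case: eqP => [E|_]; first by rewrite E (negbTE vA) in xA.
    case: eqP => [E|_]; first by rewrite E (negbTE vA) in yA.
    exact: inj.
- by rewrite (negbTE vr).
move=> x /setU1P[-> _|xA xr].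
  have /card_gt0P[u] := d; rewrite inE => /andP[uA vu].
  exists u; rewrite eqxx inE uA orbT; split=> //.
  by case: eqP => [E|_]; [rewrite E (negbTE vA) in uA | apply: rkM].
have [u [uA xu ux]] := par x xA xr; exists u; rewrite inE uA orbT; split=> //.
case: eqP => [E|_]; first by rewrite E (negbTE vA) in uA.
by case: eqP => [E|_]; first by rewrite E (negbTE vA) in xA.
Qed.

(* The parent of a vertex is its *earliest* neighbour; this is what makes the
   tree edges inside a clique form a star. *)
Definition search_tree (G : sgraph) (root : G) (rk : G -> nat) (p : G -> G) :=
  [/\ injective rk, rk root = 0, p root = root &
   forall v, v != root ->
     [/\ adj v (p v), rk (p v) < rk v & forall u, adj v u -> rk (p v) <= rk u]].

Lemma search_tree_exists (G : sgraph) (root : G) : connected G ->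
  exists rk p, search_tree root rk p.
Proof.
move=> /(search_order root)[rk [inj rk0 par]].
(* [[arg min ...]] needs a starting element satisfying its predicate; the default [v] occurs only
   for a vertex without neighbours, hence never for a non-root. *)
pose nb (v : G) := odflt v [pick u | adj v u].
pose p v := if v == root then root else [arg min_(u < nb v | adj v u) rk u].
exists rk, p; split=> // [|v vr]; first by rewrite /p eqxx.
have [w vw wv] := par v vr.
have vnb : adj v (nb v).
  by rewrite /nb; case: pickP => // no; rewrite no in vw.
suff [vp pmin] : adj v (p v) /\ forall u, adj v u -> rk (p v) <= rk u.
  by split=> //; apply: leq_ltn_trans wv; apply: pmin.
by rewrite /p (negbTE vr); case: (arg_minnP rk vnb).
Qed.

Section Detree.
Variables (G : sgraph) (p : G -> G).

Definition detree_adj : rel G := fun x y => [&& adj x y, p x != y & p y != x].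

Lemma detree_sym : symmetric detree_adj.
Proof. by move=> x y; rewrite /detree_adj adj_sym [X in _ && X]andbC. Qed.

Lemma detree_irr : irreflexive detree_adj.
Proof. by move=> x; rewrite /detree_adj adj_irr. Qed.

Definition detree : sgraph := SGraph detree_sym detree_irr.

Lemma clique_detree (S : {set G}) : clique (S : {set detree}) -> clique S.
Proof.
move=> /cliqueP cS; apply/cliqueP=> x y xS yS xy.
by have /and3P[] := cS x y xS yS xy.
Qed.

Variables (root : G) (rk : G -> nat).
Hypothesis tree : search_tree root rk p.

Let rk_inj : injective rk. Proof. by case: tree. Qed.
Let rk_root : rk root = 0. Proof. by case: tree. Qed.
Let p_root : p root = root. Proof. by case: tree. Qed.
Let p_adj v : v != root -> adj v (p v).
Proof. by case: tree => _ _ _ H /H[]. Qed.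
Let p_lt v : v != root -> rk (p v) < rk v.
Proof. by case: tree => _ _ _ H /H[]. Qed.
Let p_min v u : v != root -> adj v u -> rk (p v) <= rk u.
Proof. by case: tree => _ _ _ H /H[_ _]; apply. Qed.

(** Sending a non-root [v] to [[set v; p v]] is injective: two vertices with the same tree edge
    would be parents of each other, although ranks decrease along [p]. *)
Lemma detree_edges :
  (kcl 2 [set: G]).+1 = kcl 2 [set: detree] + #|G|.
Proof.
pose T : {set {set G}} := [set [set v; p v] | v in [set~ root]].
have in_T x y : x != y -> ([set x; y] \in T) = (p x == y) || (p y == x).
  move=> xy; apply/imsetP/orP => [[v _ E]|].
    have /set2P xv : x \in [set v; p v] by rewrite -E set21.
    have /set2P yv : y \in [set v; p v] by rewrite -E set22.
    case: xv yv xy => -> [] ->; rewrite ?eqxx //; by [left|right].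
  case=> /eqP E.
    exists x; rewrite ?E // !inE; apply: contraNneq xy => xr.
    by rewrite -E xr p_root.
  exists y; rewrite ?E 1?setUC // !inE; apply: contraNneq xy => yr.
  by rewrite -E yr p_root.
have cT : #|T|.+1 = #|G|.
  rewrite card_in_imset => [|v w].
    by rewrite cardsC1 prednK //; apply/card_gt0P; exists root.
  rewrite !inE => vr wr E; apply/eqP; apply: contraT => vw.
  have /set2P[E1|E1] : v \in [set w; p w] by rewrite -E set21.
    by rewrite E1 eqxx in vw.
  have /set2P[E2|E2] : w \in [set v; p v] by rewrite E set21.
    by rewrite E2 eqxx in vw.
  by have := p_lt vr; have := p_lt wr; rewrite -E1 -E2; lia.
rewrite -cT addnS; congr _.+1; rewrite /kcl -(cardsID T) addnC; congr (_ + _).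
  apply: eq_card => S; rewrite !inE !subsetT /=.
  have [/cards2P[x [y [xy ->]]]|] := boolP (#|S| == 2); last by rewrite !andbF.
  by rewrite in_T // !andbT !clique_set2 //= /detree_adj negb_or andbC.
rewrite setIC; apply: eq_card => S; rewrite inE.
have [/imsetP[v]|//] := boolP (S \in T); rewrite !inE => vr ->.
have := p_adj vr => av.
have vp : v != p v by apply: contraTneq av => <-; rewrite adj_irr.
by rewrite subsetT clique_set2 // av cards2 vp.
Qed.

(** Inverse of deleting the first vertex from a clique with a tree edge: that vertex is the
    highest-ranked parent of the remaining ones. Ranks are distinct, so at most one vertex is
    added. *)
Definition cone (Q : {set G}) : {set G} :=
  [set p b | b in [set b in Q | [forall c in Q, rk (p c) <= rk (p b)]]] :|: Q.

Variable k : nat.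
Hypothesis k_gt0 : 0 < k.

Let KG := @kcliques G k.+1 setT.
Let KD : {set {set G}} := @kcliques detree k.+1 setT.
Let KD' : {set {set G}} := @kcliques detree k setT.

Let KD_sub : KD \subset KG.
Proof.
by apply/subsetP=> S; rewrite !inE => /and3P[_ /clique_detree-> ->]; rewrite subsetT.
Qed.

(** Let [a = p b] for a tree edge of the clique [S]. As the earliest neighbour of [b], [a] comes
    first in [S]. Every other [c] in [S] is adjacent to [a], so its parent is not later than [a] and
    lies outside [S :\ a]. Hence [S :\ a] has no tree edge, and [b] shows that its highest parent is
    [a]. *)
Let tree_clique_cone : KG :\: KD \subset cone @: KD'.
Proof.
apply/subsetP=> S; rewrite !inE !subsetT /= => /andP[nS /andP[cS sS]].
move: nS; rewrite sS andbT => nS.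
have [b [bS pbS bp]] : exists b, [/\ b \in S, p b \in S & b != p b].
  move: nS; rewrite negb_forall_in => /exists_inP[x xS].
  rewrite negb_forall_in => /exists_inP[y yS].
  rewrite negb_imply /= /detree_adj => /andP[xy].
  rewrite (cliqueP _ cS) //= negb_and !negbK.
  by case/orP=> /eqP E; [exists x|exists y]; rewrite E // eq_sym.
set a := p b in pbS bp.
have br : b != root by apply: contraNneq bp => E; rewrite /a E p_root.
have a_min c : c \in S -> rk a <= rk c.
  move=> cS'; have [->|cb] := eqVneq c b; first exact/ltnW/p_lt.
  by apply: p_min => //; apply: (cliqueP _ cS) => //; rewrite eq_sym.
have nroot c : c \in S :\ a -> c != root.
  case/setD1P=> ca cS'; apply: contraNneq ca => E; apply/eqP/rk_inj.
  by have := a_min c cS'; rewrite E rk_root; lia.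
have p_le c : c \in S :\ a -> rk (p c) <= rk a.
  move=> cSa; have /setD1P[ca cS'] := cSa.
  by apply: p_min; [apply: nroot | apply: (cliqueP _ cS)].
have bSa : b \in S :\ a by rewrite !inE bp.
have p_ne x y : x \in S :\ a -> y \in S :\ a -> p x != y.
  move=> xS /setD1P[ya yS]; apply: contraNneq ya => E; apply/eqP/rk_inj.
  by have := p_le x xS; have := a_min y yS; rewrite E; lia.
apply/imsetP; exists (S :\ a).
  rewrite !inE subsetT /=; apply/andP; split; last first.
    by move: sS; rewrite (cardsD1 a) pbS.
  apply/cliqueP=> x y xS yS xy; rewrite /= /detree_adj !p_ne // !andbT.
  by have := sub_clique (subsetDl S [set a]) cS => /cliqueP; apply.
rewrite /cone -{1}(setD1K pbS); congr (_ :|: _).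
apply/setP=> x; rewrite inE; apply/eqP/imsetP => [->|[c]].
  exists b => //; rewrite inE bSa /=; apply/forall_inP=> c.
  by apply: p_le.
rewrite inE => /andP[cSa /forall_inP/(_ b bSa) le] ->.
by apply/rk_inj/eqP; rewrite eqn_leq p_le.
Qed.

Lemma kcl_detree :
  kcl k.+1 [set: G] <= kcl k.+1 [set: detree] + kcl k [set: detree].
Proof.
rewrite [leqLHS](_ : _ = #|KD| + #|KG :\: KD|).
  by rewrite leq_add2l (leq_trans (subset_leq_card tree_clique_cone)) ?leq_imset_card.
by rewrite cardsDS // subnKC // subset_leq_card.
Qed.

Hypothesis eq_detree :
  kcl k.+1 [set: detree] + kcl k [set: detree] <= kcl k.+1 [set: G].

(** Under [eq_detree] the image of [cone] has no more elements than [KG :\: KD], so the inclusion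
    [tree_clique_cone] is an equality. *)
Lemma cone_clique (Q : {set G}) :
  clique (Q : {set detree}) -> #|Q| = k -> clique (cone Q) /\ #|cone Q| = k.+1.
Proof.
move=> cQ sQ.
have E : KG :\: KD = cone @: KD'.
  apply/eqP; rewrite eqEcard tree_clique_cone cardsDS //=.
  rewrite (leq_trans (leq_imset_card _ _)) //.
  by rewrite leq_subRL ?subset_leq_card.
have : cone Q \in KG :\: KD.
  by rewrite E imset_f // inE subsetT cQ sQ eqxx.
by rewrite !inE => /andP[_ /and3P[_ -> /eqP]].
Qed.

(** The extending vertex is the highest-ranked parent [p b] over [Q]. For each [c] in [Q], a
    [k]-subset [S] containing [b] and [c] has this same vertex in its cone, and [cone S] is a
    clique. *)
Lemma detree_clique_ext (Q : {set G}) : 1 < k <= #|Q| ->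
  clique (Q : {set detree}) -> exists a, Q \subset nbh setT a.
Proof.
case/andP=> k1 kQ cQ.
have /card_gt0P[b0 b0Q] : 0 < #|Q| by lia.
case: (arg_maxnP (fun b => rk (p b)) b0Q) => b bQ bmax.
exists (p b); apply/subsetP=> c cQ'; rewrite inE in_setT /=.
have sub2 : [set b; c] \subset Q by apply/subsetP=> x /set2P[]->.
have [|S [S2 SQ sS]] := exists_subset_between (k := k) sub2.
  by rewrite kQ andbT cards2; case: (_ != _) => //; lia.
have bS : b \in S by rewrite (subsetP S2) ?set21.
have cS : c \in S by rewrite (subsetP S2) ?set22.
have [cC sC] := cone_clique (@sub_clique detree _ _ SQ cQ) sS.
have pC : p b \in cone S.
  apply/setUP; left; apply: imset_f; rewrite inE bS; apply/forall_inP=> d dS.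
  by apply: bmax; apply: (subsetP SQ).
(* If [p b] were in [S], the cone would add nothing, whereas it must have [k.+1] vertices. *)
have pS : p b \notin S.
  apply/negP=> pS; have /subset_leq_card : cone S \subset S; last by rewrite sC sS ltnn.
  rewrite subUset subxx andbT; apply/subsetP=> x /imsetP[d].
  rewrite inE => /andP[dS /forall_inP/(_ b bS) le] ->.
  rewrite (_ : p d = p b) //; apply/rk_inj/eqP; rewrite eqn_leq le andbT.
  by apply: bmax; apply: (subsetP SQ).
apply: (cliqueP _ cC) => //; first by rewrite /cone inE cS orbT.
by apply: contraNneq pS => ->.
Qed.
End Detree.

(** [rho] and [tau] stand for [r - 1] and [t - 1]. The lower bound on cliques makes [kcl_detree] and
    [weight_edges] both tight: the second yields a [rho]-clique of [detree], the first a common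
    neighbour of it in [G]. *)
Lemma large_clique (G : sgraph) (k rho tau : nat) : connected G ->
  1 < k <= rho -> tau <= rho ->
  (kcl 2 [set: G]).+1 = 'C(rho, 2) + tau + #|G| ->
  'C(rho.+1, k.+1) + 'C(tau.+1, k) <= kcl k.+1 [set: G] ->
  exists R : {set G}, clique R /\ #|R| = rho.+1.
Proof.
move=> G_conn /andP[k1 kr] tr e2 le.
have [root _] : exists x : G, x \in [set: G].
  apply/set0Pn; apply: contraTneq le => ->; rewrite kcl_set0 -ltnNge.
  by rewrite addn_gt0 bin_gt0 ltnS kr.
have [rk [p tree]] := search_tree_exists root G_conn.
have k0 := ltnW k1.
have le1 := kcl_detree tree k0.
have e2' : kcl 2 [set: detree p] = 'C(rho, 2) + tau.
  by have := detree_edges tree; lia.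
have [le2 /(_ kr)] := weight_edges k1 tr e2'.
case=> [|Q [_ cQ sQ]]; first lia.
have [||a aQ] := detree_clique_ext tree k0 _ _ cQ; [lia|by rewrite k1 sQ kr|].
exists (a |: Q); split; first exact: clique_setU1 aQ (clique_detree cQ).
rewrite cardsU1 sQ; suff -> : a \notin Q by [].
by apply: contra (nbh_notin setT a); apply: (subsetP aQ).
Qed.

(* Grow [R] to the whole graph: a new vertex with [d] back neighbours raises
   the excess by [d - 1] and creates at most ['C(d, k)] cliques.  By convexity
   the maximum is attained only if a single vertex takes all the excess; the
   graph built before that vertex is [R] with trees attached, so its cliques
   of size at least 3 lie in [R]. *)
Lemma clique_growth (G : sgraph) (k y : nat) (R : {set G}) : connected G ->
  1 < k <= y.+1 -> clique R -> 0 < #|R| ->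
  kcl 2 [set: G] + #|R| = 'C(#|R|, 2) + #|G| + y ->
  'C(#|R|, k.+1) + 'C(y.+1, k) <= kcl k.+1 [set: G] ->
  (exists2 v, v \notin R & y < #|nbh R v|) \/
  y = 1 /\ exists S : {set G}, [/\ clique S, #|S| = 3 & #|S :&: R| <= 1].
Proof.
move=> G_conn /andP[k1 ky] cR R0 e2 le.
pose out y := (exists2 v, v \notin R & y < #|nbh R v|) \/
  y = 1 /\ exists S : {set G}, [/\ clique S, #|S| = 3 & #|S :&: R| <= 1].
(* The excess [y] varies during the growth. The third clause keeps all cliques of at least three
   vertices inside [R] while the excess is zero; the last carries the structure forced by
   equality. *)
pose P (A : {set G}) := exists y,
  [/\ kcl 2 A + #|R| = 'C(#|R|, 2) + #|A| + y,
      kcl k.+1 A <= 'C(#|R|, k.+1) + 'C(y.+1, k),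
      y = 0 -> forall S : {set G}, S \subset A -> clique S -> 2 < #|S| ->
        S \subset R &
      k <= y.+1 -> 'C(#|R|, k.+1) + 'C(y.+1, k) <= kcl k.+1 A -> out y].
suff [y' [e2' _ _ PT]] : P setT.
  have E : y' = y by move: e2'; rewrite cardsT; lia.
  by rewrite E in PT; apply: PT.
have R_neq0 : R != set0 by rewrite -card_gt0.
apply: (growth (P := P) G_conn R_neq0) => [|A v RA vA d1].
  exists 0; rewrite !kcl_clique // addn0 leq_addr; split=> //; lia.
have vR : v \notin R by apply: contra vA; apply: (subsetP RA).
case=> y0 [e2' ub tri eqb]; set N := nbh A v in d1 *; set d := #|N| in d1 *.
have kN : kcl k N <= 'C(d, k) by apply: kcl_le_bin.
have C1 : 'C(1, k) = 0 by rewrite bin_small.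
(* As ['C(1, k) = 0], convexity merges the contributions of [d] and of [y0.+1] into that of
   [d + y0], so the clique bound survives the addition of [v]. *)
have ex := @bin_exchange k d 1 y0 d1; rewrite C1 addn0 add1n in ex.
have Ey : (y0 + d.-1).+1 = d + y0 by lia.
exists (y0 + d.-1); rewrite !kclU1 // kcl1 cardsU1 vA -/N -/d Ey.
split=> [||y0d S SA cS S3|kd leA]; [lia|lia| |].
  apply: tri => //; first lia.
  have [vS|vS] := boolP (v \in S); last first.
    apply/subsetP=> x xS; have := subsetP SA x xS.
    by rewrite !inE; case: eqP xS vS => [-> ->|].
  suff : S :\ v \subset N.
    by move/subset_leq_card; rewrite -/d; move: S3; rewrite (cardsD1 v S) vS; lia.
  apply/subsetP=> x; rewrite !inE => /andP[xv xS].
  have := subsetP SA x xS; rewrite !inE (negbTE xv) /= => -> /=.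
  by apply: (cliqueP _ cS) => //; rewrite eq_sym.
have [d_1|d_gt1] : d = 1 \/ 1 < d by lia.
  by move: kN leA kd; rewrite d_1 C1 addn0 add1n => kN leA kd; apply: eqb => //; lia.
have y00 : y0 = 0.
  apply/eqP; rewrite -leqn0 leqNgt; apply/negP=> y_gt0.
  have := @bin_exchange_lt k d 1 y0; rewrite k1 kd C1 addn0 add1n.
  by move=> /(_ isT y_gt0 d_gt1); lia.
move: kd leA ub; rewrite y00 addn0 C1 addn0 => kd leA ub.
have cN : clique N by apply: (@kcl_eq_bin _ k); rewrite -/d ?k1 //; lia.
have Nv : N \subset nbh setT v by apply: nbhS; apply: subsetT.
have inR : N \subset R -> out (0 + d.-1).
  move=> NR; left; exists v => //; rewrite add0n prednK //.
  apply/subset_leq_card/subsetP=> x xN; rewrite inE (subsetP NR) //=.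
  by move: xN; rewrite inE => /andP[].
(* With at least three vertices the clique [N] lies in [R] by [tri]. With two it is an edge that may
   leave [R], and then it forms the exceptional triangle with [v]. *)
have [d3|d3] := ltnP 2 d; first by apply/inR/tri => //; apply: nbh_sub.
have d2 : d = 2 by lia.
have [NR|/subsetPn[z zN zR]] := boolP (N \subset R); first exact: inR.
right; rewrite d2; split=> //; exists (v |: N); split.
- exact: clique_setU1.
- by rewrite cardsU1 nbh_notin -/d d2.
have: (v |: N) :&: R \subset N :\ z.
  apply/subsetP=> x; rewrite !inE => /andP[/predU1P[->|]]; first by rewrite (negbTE vR).
  by move=> /andP[-> ->] xR; rewrite !andbT; apply: contraNneq zR => <-.
move/subset_leq_card; move: d2; rewrite /d (cardsD1 z N) zN; lia.
Qed.

(** * Recognizing the core *)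

Lemma imset_kcliques (G H : sgraph) (f : H -> G) k :
  injective f -> {homo f : x y / adj x y} ->
  (fun S : {set H} => f @: S) @: kcliques k [set: H] \subset
    kcliques k (f @: [set: H]).
Proof.
move=> f_inj f_hom; apply/subsetP=> _ /imsetP[S + ->]; rewrite !inE.
case/and3P=> _ /cliqueP cS /eqP <-; rewrite card_imset // eqxx andbT.
rewrite imsetS ?subsetT //=.
apply/cliqueP=> _ _ /imsetP[x xS ->] /imsetP[y yS ->] xy.
by apply/f_hom/cS => //; apply: contraNneq xy => ->.
Qed.

Lemma kcl_imset (G H : sgraph) (f : H -> G) k :
  injective f -> {homo f : x y / adj x y} ->
  kcl k [set: H] <= kcl k (f @: [set: H]).
Proof.
move=> f_inj f_hom.
rewrite -[leqLHS](card_imset (kcliques k [set: H]) (imset_inj f_inj)).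
exact/subset_leq_card/imset_kcliques.
Qed.

Lemma iso_induced (G H : sgraph) (W : {set G}) (f : H -> G) :
  injective f -> {mono f : x y / adj x y} -> f @: [set: H] = W ->
  iso (induced W) H.
Proof.
move=> f_inj f_mono fW.
have fP x : f x \in W by rewrite -fW imset_f.
pose h x : induced W := exist _ (f x) (fP x).
have h_inj : injective h by move=> x y /(congr1 val) /f_inj.
have [|g hK gK] := inj_card_bij h_inj.
  by rewrite card_sig -[leqLHS](_ : #|W| = _) ?cardsE // -fW card_imset // cardsT.
exists g; first by exists h.
by move=> x y; rewrite -[in RHS](gK x) -[in RHS](gK y) -f_mono.
Qed.

Lemma core_sub (G : sgraph) (W : {set G}) (j y : nat) : connected G ->
  W != set0 -> y < j -> kcl 2 [set: G] + #|W| <= kcl 2 W + #|G| + y ->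
  core_set G j \subset W.
Proof.
move=> G_conn W_neq0 yj le; apply: (growth_core G_conn W_neq0 le) => v vC.
exact: leq_ltn_trans yj (core_set_deg vC).
Qed.

Lemma imset_sub_core (G H : sgraph) (f : H -> G) (j : nat) :
  injective f -> {homo f : x y / adj x y} ->
  (forall x : H, j < #|nbh setT x|) -> f @: [set: H] \subset core_set G j.
Proof.
move=> f_inj f_hom deg; apply: core_set_max => _ /imsetP[x _ ->].
apply: leq_trans (deg x) _; rewrite -(card_imset _ f_inj).
apply/subset_leq_card/subsetP=> _ /imsetP[y + ->].
by rewrite !inE imset_f //= => /f_hom.
Qed.

(** The image of [H] has at least the edges of [H], and by [growth_edges] no more than [e2] allows.
    So every edge inside the image comes from [H], and no excess is left for core vertices outside
    it. *)
Lemma core_iso (G H : sgraph) (f : H -> G) (j : nat) : connected G -> 0 < j ->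
  0 < #|H| -> injective f -> {homo f : x y / adj x y} ->
  kcl 2 [set: G] + #|H| <= kcl 2 [set: H] + #|G| ->
  (forall x : H, j < #|nbh setT x|) -> iso (core G j) H.
Proof.
move=> G_conn j0 H0 f_inj f_hom e2 deg.
set W := f @: [set: H].
have cW : #|W| = #|H| by rewrite card_imset // cardsT.
have W_neq0 : W != set0 by rewrite -card_gt0 cW.
have le1 := kcl_imset 2 f_inj f_hom; rewrite -/W in le1.
have le2 := growth_edges G_conn W_neq0; rewrite cW in le2.
apply: (iso_induced f_inj).
  move=> x y; apply/idP/idP => [fxy|]; last exact: f_hom.
  have xy : f x != f y by apply: contraTneq fxy => ->; rewrite adj_irr.
  have E : (fun S : {set H} => f @: S) @: kcliques 2 [set: H] = kcliques 2 W.
    apply/eqP; rewrite eqEcard imset_kcliques // card_imset; last exact: imset_inj.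
    by rewrite -/(kcl 2 W) -/(kcl 2 [set: H]); lia.
  have : [set f x; f y] \in kcliques 2 W.
    rewrite inE clique_set2 // fxy cards2 xy andbT.
    by apply/subsetP=> u /set2P[]->; rewrite imset_f.
  rewrite -E => /imsetP[S]; rewrite inE => /and3P[_ /cliqueP cS _].
  have -> : [set f x; f y] = f @: [set x; y] by rewrite imsetU1 imset_set1.
  move/(imset_inj f_inj) => ES; apply: cS; rewrite -?ES ?set21 ?set22 //.
  by apply: contraNneq xy => ->.
apply/eqP; rewrite eqEsubset imset_sub_core //=.
by apply: (core_sub (y := 0)); rewrite // -/W cW; lia.
Qed.

(** * The extremal graphs *)

Definition initial n (i : nat) : {set 'I_n} := [set x : 'I_n | x < i].

Lemma initialS n (x : 'I_n) : initial n x.+1 = x |: initial n x.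
Proof. by apply/setP=> y; rewrite !inE ltnS leq_eqVlt. Qed.

Lemma initial_notin n (x : 'I_n) : x \notin initial n x.
Proof. by rewrite inE ltnn. Qed.

Lemma initial_full n : initial n n = setT.
Proof. by apply/setP=> y; rewrite !inE ltn_ord. Qed.

Lemma card_initial n i : i <= n -> #|initial n i| = i.
Proof.
elim: i => [|i IH] lt.
  by apply/eqP; rewrite cards_eq0; apply/eqP/setP=> y; rewrite !inE.
by rewrite (initialS (Ordinal lt)) cardsU1 initial_notin IH // ltnW.
Qed.

(* [K_r^t] on [0, ..., r], with the remaining vertices pendant at 0. *)
Definition extremal (n r t : nat) : sgraph :=
  from_rel (fun x y : 'I_n =>
    (x < y) && [|| y < r, (y == r :> nat) && (x < t) | x == 0 :> nat]).

Lemma extremal_adj n r t (x y : extremal n r t) : (x : 'I_n) < (y : 'I_n) ->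
  adj x y = [|| (y : 'I_n) < r, ((y : 'I_n) == r :> nat) && ((x : 'I_n) < t)
              | (x : 'I_n) == 0 :> nat].
Proof.
move=> xy; have yx : ((y : 'I_n) < (x : 'I_n)) = false by rewrite ltnNge ltnW.
rewrite /= /sym_rel xy yx /= orbF.
by case: eqP => // E; rewrite E ltnn in xy.
Qed.

Section Extremal.
Variables n r t : nat.
Hypotheses (t_gt0 : 0 < t) (t_le : t <= r) (r_lt : r < n).
Let H := extremal n r t.

Let clique_initial : clique (initial n r : {set H}).
Proof.
apply/cliqueP=> x y; rewrite !inE => xr yr xy.
have [lt|lt|E] := ltngtP (x : 'I_n) (y : 'I_n).
- by rewrite extremal_adj // yr.
- by rewrite adj_sym extremal_adj // xr.
- by rewrite (ord_inj E) eqxx in xy.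
Qed.

Let kcl_r k : kcl k.+1 (initial n r.+1 : {set H}) = 'C(r, k.+1) + 'C(t, k).
Proof.
pose v : H := Ordinal r_lt.
rewrite (initialS (Ordinal r_lt)) (@kclU1 H _ _ v) ?initial_notin //=.
rewrite kcl_clique // card_initial ?(ltnW r_lt) //; congr (_ + _).
have -> : @nbh H (initial n r) v = initial n t.
  apply/setP=> x; rewrite !inE; case: (ltnP (x : 'I_n) r) => [xr|rx]; last first.
    by apply/esym/negbTE; rewrite -leqNgt (leq_trans t_le).
  rewrite andTb adj_sym extremal_adj // ltnn eqxx /=.
  by case: eqP => [->|]; rewrite ?t_gt0 ?orbF.
rewrite kcl_clique ?card_initial //; first by rewrite (leq_trans t_le) ?(ltnW r_lt).
apply: sub_clique clique_initial; apply/subsetP=> x; rewrite !inE => /leq_trans.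
exact.
Qed.

(** The first [r.+1] vertices carry [K_r^t], and every later one adds a single edge, to 0. *)
Lemma extremal_edges : kcl 2 [set: H] + r.+1 = 'C(r, 2) + t + n.
Proof.
suff E i : r < i <= n -> kcl 2 (initial n i : {set H}) + r.+1 = 'C(r, 2) + t + i.
  by rewrite -E ?r_lt ?leqnn // initial_full.
elim: i => // i IH /andP[]; rewrite ltnS leq_eqVlt => /predU1P[<- _|ri lt].
  by rewrite kcl_r bin1.
have := IH; rewrite ri (ltnW lt) => /(_ isT) {}IH.
pose v : H := Ordinal lt.
rewrite (initialS (Ordinal lt)) (@kcl2U1 H _ v) ?initial_notin //=.
have n0 : 0 < n := leq_ltn_trans (leq0n i) lt.
suff -> : @nbh H (initial n i) v = [set Ordinal n0 : H] by rewrite cards1; lia.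
apply/setP=> x; rewrite !inE; have [xi|ix] := ltnP (x : 'I_n) i.
  by rewrite andTb adj_sym extremal_adj //= ltnNge ltnW //= gtn_eqF.
by rewrite andFb; apply/esym/negbTE;
  apply: contraTneq ix => ->; rewrite -ltnNge; apply: leq_ltn_trans ri.
Qed.

Lemma extremal_cliques k : 'C(r, k.+1) + 'C(t, k) <= kcl k.+1 [set: H].
Proof. by rewrite -kcl_r kclS ?subsetT. Qed.

Lemma extremal_connected : connected H.
Proof.
have n0 : 0 < n by apply: leq_trans r_lt.
pose z : H := Ordinal n0.
have zx x : connect (@adj H) z x.
  have [->|xz] := eqVneq x z; first exact: connect0.
  apply/connect1; have x0 : 0 < (x : 'I_n).
    by rewrite lt0n; apply: contraNneq xz => E; apply/eqP/ord_inj.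
  by rewrite extremal_adj //= orbT orbT.
move=> x y; apply: connect_trans (zx y).
by rewrite (sym_connect_sym (@adj_sym H)).
Qed.
End Extremal.

Lemma complete_plus_edges r t : t <= r ->
  'C(r, 2) + t <= kcl 2 [set: complete_plus r t].
Proof.
move=> tr; pose A : {set complete_plus r t} := Some @: [set: 'I_r].
have nA : (None : complete_plus r t) \notin A by apply/imsetP=> [[]].
have cA : clique A.
  apply/cliqueP=> _ _ /imsetP[x _ ->] /imsetP[y _ ->] xy.
  by rewrite /= /sym_rel xy.
have sA : #|A| = r by rewrite card_imset ?cardsT ?card_ord //; apply: Some_inj.
pose v : complete_plus r t := None.
have le := kclS 2 (subsetT (v |: A)); apply: leq_trans le.
rewrite kcl2U1 // kcl_clique // sA leq_add2l.
rewrite -[leqLHS](card_initial tr) -(card_imset _ (@Some_inj _)).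
apply/subset_leq_card/subsetP=> _ /imsetP[x + ->]; rewrite !inE => xt.
by rewrite imset_f // /v /= /sym_rel /= xt.
Qed.

(** A vertex of [K_r] not joined to [None] has degree [r - 1], which exceeds [j] if [j.+1 < r]; if
    [t = r], there is no such vertex. *)
Lemma complete_plus_deg r t j : j < t -> j.+1 < r \/ t = r ->
  forall x : complete_plus r t, t <= r -> j < #|nbh setT x|.
Proof.
move=> jt jr [i|] tr; last first.
  apply: leq_trans jt _; rewrite -[leqLHS](card_initial tr) -(card_imset _ (@Some_inj _)).
  apply/subset_leq_card/subsetP=> _ /imsetP[x + ->]; rewrite !inE => xt.
  by rewrite /= /sym_rel /= xt.
pose A : {set complete_plus r t} := Some @: [set~ i].
have nA : (None : complete_plus r t) \notin A by apply/imsetP=> [[]].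
have sA : #|A| = r.-1.
  by rewrite card_imset ?cardsC1 ?card_ord //; apply: Some_inj.
have AN : A \subset nbh setT (Some i : complete_plus r t).
  apply/subsetP=> _ /imsetP[x + ->]; rewrite !inE => xi.
  rewrite /= /sym_rel /= andbT; apply: contra xi.
  by rewrite (inj_eq (@Some_inj _)) eq_sym.
case: jr => [jr|E].
  by apply: leq_trans (subset_leq_card AN); rewrite sA; lia.
have : None |: A \subset nbh setT (Some i : complete_plus r t).
  by rewrite subUset AN andbT sub1set inE in_setT /= /sym_rel /= E ltn_ord.
move/subset_leq_card; apply: leq_trans; rewrite cardsU1 nA sA; have := ltn_ord i; lia.
Qed.

Section Path.
Variables (r l : nat).
Hypothesis r_ge3 : 2 < r.
Let b := r.-1 + l.
Let H := clique_path_cycle r l 3.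
Let e (x y : nat) :=
  [|| (x < r) && (y < r), (r.-1 <= x < b) && (y == x.+1 :> nat)
    | [&& b <= x, b <= y & y - b == (x - b).+1 %% 3]].

Let b_def : b = r.-1 + l. Proof. by []. Qed.

Let H_adj (x y : H) : adj x y = (x != y) && (e x y || e y x).
Proof. by []. Qed.

(** Past [K_r], each vertex up to [b + 1] has an edge to its predecessor, and the last vertex closes
    the triangle with [b] and [b + 1]. *)
Lemma clique_path_cycle_edges :
  'C(r, 2) + l + 3 <= kcl 2 [set: clique_path_cycle r l 3].
Proof.
have cr : clique (initial (b + 3) r : {set H}).
  apply/cliqueP=> x y; rewrite !inE => xr yr xy.
  by rewrite H_adj xy /e xr yr.
have base : kcl 2 (initial (b + 3) r : {set H}) = 'C(r, 2).
  by rewrite kcl_clique // card_initial // /b; lia.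
have lo i : r <= i <= b + 2 ->
    'C(r, 2) + i <= kcl 2 (initial (b + 3) i : {set H}) + r.
  elim: i => [|i IH] /andP[]; first lia.
  rewrite leq_eqVlt => /predU1P[<- _|ri lt]; first by rewrite base.
  have lt' : i < b + 3 by lia.
  have lt1 : i.-1 < b + 3 by lia.
  pose v : H := Ordinal lt'; pose u : H := Ordinal lt1.
  rewrite (initialS (Ordinal lt')) (@kcl2U1 H _ v) ?initial_notin //=.
  have {}IH : 'C(r, 2) + i <= kcl 2 (initial (b + 3) i : {set H}) + r.
    by apply: IH; lia.
  suff pos : 0 < #|@nbh H (initial (b + 3) i) v|.
    by rewrite addnS addnAC -addn1 leq_add.
  apply/card_gt0P; exists u; rewrite inE H_adj !inE /= -val_eqE /e /=; lia.
have lt' : b + 2 < b + 3 by lia.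
have lt1 : b + 1 < b + 3 by lia.
have lt0 : b < b + 3 by lia.
pose v : H := Ordinal lt'; pose u : H := Ordinal lt1; pose w : H := Ordinal lt0.
rewrite -[setT](@initial_full (b + 3)).
have -> : initial (b + 3) (b + 3) = v |: initial (b + 3) (b + 2).
  by rewrite -(initialS (Ordinal lt')) /= -addnS.
rewrite (@kcl2U1 H _ v) ?initial_notin //=.
have lo2 : 'C(r, 2) + (b + 2) <= kcl 2 (initial (b + 3) (b + 2) : {set H}) + r.
  by apply: lo; lia.
suff two : 2 <= #|@nbh H (initial (b + 3) (b + 2)) v|.
  have -> : 'C(r, 2) + l + 3 = 'C(r, 2) + (b + 2) - r + 2 by lia.
  by rewrite leq_add // leq_subLR [leqRHS]addnC.
rewrite -[leqLHS](_ : #|[set u; w]| = 2); last first.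
  by rewrite cards2 -val_eqE /=; lia.
apply/subset_leq_card/subsetP=> x /set2P[]->.
  by rewrite inE H_adj !inE /= -val_eqE /e /=; lia.
by rewrite inE H_adj !inE /= -val_eqE /e /=; lia.
Qed.

Lemma clique_path_cycle_deg (x : clique_path_cycle r l 3) : 1 < #|nbh setT x|.
Proof.
suff [u [w [uw xu xw]]] : exists u w : H, [/\ u != w, adj x u & adj x w].
  suff /subset_leq_card : [set u; w] \subset nbh setT (x : H) by rewrite cards2 uw.
  by apply/subsetP=> y /set2P[]->; rewrite inE in_setT.
suff [i [k [ib kb ik /andP[xi ei] /andP[xk ek]]]] : exists i k : nat,
    [/\ i < b + 3, k < b + 3, i != k,
        ((x : 'I__) != i :> nat) && (e (x : 'I__) i || e i (x : 'I__)) &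
        ((x : 'I__) != k :> nat) && (e (x : 'I__) k || e k (x : 'I__))].
  by exists (Ordinal ib), (Ordinal kb); rewrite !H_adj -!val_eqE /= xi xk.
have := ltn_ord x; move: (nat_of_ord x) => {x} x xb; rewrite /e.
have [xr|rx] := ltnP x r.
  have [->|x0] := eqVneq x 0; first by exists 1, 2; split; lia.
  have [->|x1] := eqVneq x 1; first by exists 0, 2; split; lia.
  by exists 0, 1; split; lia.
have [xb1|bx] := ltnP x b; first by exists x.-1, x.+1; split; lia.
have [E|[E|E]] : x = b \/ x = b + 1 \/ x = b + 2 by lia.
- by exists x.-1, (b + 1); split; lia.
- by exists b, (b + 2); split; lia.
- by exists b, (b + 1); split; lia.
Qed.
End Path.

(** * Embedding the extremal cores *)

Lemma complete_plus_embedding (G : sgraph) (R : {set G}) v t :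
  clique R -> v \notin R -> t <= #|nbh R v| ->
  exists f : complete_plus #|R| t -> G,
    injective f /\ {homo f : x y / adj x y}.
Proof.
move=> cR vR tN; set N := nbh R v in tN.
(* Listing the neighbours of [v] first makes the indices below [t] point to neighbours of [v]. *)
pose w := enum N ++ enum (R :\: N).
have NR : N \subset R by apply: nbh_sub.
have szw : size w = #|R|.
  by rewrite size_cat -!cardE cardsDS // subnKC // subset_leq_card.
have w_uniq : uniq w.
  rewrite cat_uniq !enum_uniq andbT /=; apply/hasPn=> x.
  by rewrite !mem_enum inE => /andP[].
have wR i : i < #|R| -> nth v w i \in R.
  rewrite -szw => lt; have := mem_nth v lt; rewrite mem_cat !mem_enum in_setD.
  by case/orP=> [xN|/andP[]//]; apply: (subsetP NR).
have wN i : i < t -> adj v (nth v w i).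
  move=> it; have iN : i < size (enum N) by rewrite -cardE (leq_trans it).
  rewrite nth_cat iN; have := mem_nth v iN; rewrite mem_enum inE.
  by case/andP.
exists (fun x : option 'I_#|R| => if x is Some i then nth v w i else v); split.
  move=> [i|] [j|] //= E.
  - by congr Some; apply/ord_inj/eqP; rewrite -(nth_uniq v _ _ w_uniq) ?szw ?E.
  - by have := wR i (ltn_ord i); rewrite E (negbTE vR).
  - by have := wR j (ltn_ord j); rewrite -E (negbTE vR).
move=> [i|] [j|]; rewrite /= /sym_rel /=.
- rewrite andbT => ij; apply: (cliqueP _ cR); rewrite ?wR //.
  by rewrite nth_uniq ?szw ?ltn_ord.
- by move=> it; rewrite adj_sym wN.
- by rewrite orbF; apply: wN.
- by [].
Qed.

(** Descent on the length: a later visit to [A] lets the path start there, an earlier visit to [B]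
    lets it end there. *)
Lemma connecting_path (G : sgraph) (A B : {set G}) : connected G ->
  A != set0 -> B != set0 ->
  exists x p, [/\ x \in A, path (@adj G) x p, last x p \in B, uniq (x :: p) &
    {in p, forall z, z \notin A} /\ {in belast x p, forall z, z \notin B}].
Proof.
move=> G_conn /set0Pn[x xA] /set0Pn[y yB].
have /connectP[p xp yp] := G_conn x y; rewrite yp in yB.
case/shortenP: xp yB => {yp} q xq q_uniq _ yB.
have [N] := ubnP (size q); elim: N => // N IH in x q xA xq q_uniq yB *.
move=> szq.
have [/hasP[z zq zA]|/hasPn qA] := boolP (has (mem A) q).
  case/splitPr: zq xq q_uniq yB szq => p1 p2.
  rewrite cat_path last_cat /= size_cat /= => /and3P[_ _ zp2].
  move=> /andP[_]; rewrite cat_uniq => /and3P[_ _ u2] yB szq.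
  by apply: (IH z p2) => //; apply: leq_trans (leq_addl _ _) szq.
have [/hasP[z zq zB]|/hasPn qB] := boolP (has (mem B) (belast x q)); last first.
  by exists x, q; split.
have : z \in x :: q by rewrite lastI mem_rcons inE zq orbT.
move=> zxq; case/splitPl: zxq xq q_uniq yB szq zq => p1 p2 zp1.
rewrite cat_path => /andP[xp1 _] p_uniq _ szq zq.
(* [z] comes before the end of a path without repetitions, so cutting at [z] strictly shortens
   it. *)
have p2_gt0 : 0 < size p2.
  case: p2 p_uniq szq zq => // + _; rewrite cats0 lastI rcons_uniq zp1.
  by move=> /andP[/negbTE->].
apply: (IH x p1) => //; last by move: szq; rewrite size_cat; lia.
  by move: p_uniq; rewrite -cat_cons cat_uniq => /and3P[].
by rewrite zp1.
Qed.

Lemma clique_path_cycle_embedding (G : sgraph) (R S : {set G}) : connected G ->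
  clique R -> clique S -> 0 < #|R| -> #|S| = 3 -> #|S :&: R| <= 1 ->
  exists l, exists f : clique_path_cycle #|R| l 3 -> G,
    injective f /\ {homo f : x y / adj x y}.
Proof.
move=> G_conn cR cS R0 S3 SR1.
have [x [p [xR xp pS p_uniq [pR bS SR]]]] : exists x p,
    [/\ x \in R, path (@adj G) x p, last x p \in S, uniq (x :: p) &
    [/\ {in p, forall z, z \notin R}, {in belast x p, forall z, z \notin S} &
      {in S, forall z, z \in R -> z = last x p}]].
  (* A common vertex of [S] and [R] is unique and gives the path of length 0; otherwise a connecting
     path is taken. *)
  have [E|[z]] := set_0Vmem (S :&: R); last first.
    rewrite inE => /andP[zS zR]; exists z, [::]; split=> //=; split=> // y yS yR.
    by move/card_le1_eqP: SR1; apply; rewrite inE ?zS ?zR ?yS ?yR.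
  have [||x [p [xR xp pS p_uniq [pR bS]]]] := @connecting_path G R S G_conn.
  - by rewrite -card_gt0.
  - by rewrite -card_gt0 S3.
  exists x, p; split=> //; split=> // z zS zR.
  by have : z \in S :&: R; [rewrite inE zS | rewrite E inE].
set r := #|R|; set l := size p; set c := last x p in pS SR.
have r0 : 0 < r by [].
(* This order matches the numbering of [clique_path_cycle]: [x] gets index [r.-1], and the end [c]
   of the path gets [r.-1 + l]. *)
pose w := enum (R :\ x) ++ (x :: p) ++ enum (S :\ c).
have sz1 : size (enum (R :\ x)) = r.-1.
  by rewrite -cardE /r (cardsD1 x R) xR.
have sz3 : size (enum (S :\ c)) = 2.
  by rewrite -cardE; have := cardsD1 c S; rewrite pS S3 => -[].
have szw : size w = r.-1 + l + 3 by rewrite !size_cat sz1 sz3 /= /l; lia.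
have pSE z : z \in x :: p -> z \in S -> z = c.
  by rewrite lastI mem_rcons inE => /predU1P[//|/bS/negbTE->].
have w_uniq : uniq w.
  rewrite /w 2!cat_uniq !enum_uniq p_uniq andTb andTb andbT.
  apply/andP; split; apply/hasPn=> z.
    rewrite mem_cat inE !mem_enum !in_setD1.
    rewrite negb_and negbK => /orP[/predU1P[->|/pR->]|/andP[zc zS]].
    - by rewrite eqxx.
    - by rewrite orbT.
    - by apply/orP; right; apply: contra zc => /(SR _ zS)->.
  rewrite mem_enum in_setD1 => /andP[zc zS].
  by apply: contra zc => /pSE->.
have nthR i : i < r -> nth x w i \in R.
  move=> ir; rewrite nth_cat sz1; case: ltnP => [lt|ge].
    have := mem_nth x (_ : i < size (enum (R :\ x))); rewrite sz1 => /(_ lt).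
    by rewrite mem_enum inE => /andP[].
  by rewrite (_ : i - r.-1 = 0) //; lia.
have nthp k : k <= l -> nth x w (r.-1 + k) = nth x (x :: p) k.
  by move=> kl; rewrite nth_cat sz1 ltnNge leq_addr /= addKn -cat_cons nth_cat /= ltnS kl.
have nthS i : r.-1 + l <= i < r.-1 + l + 3 -> nth x w i \in S.
  case/andP; rewrite leq_eqVlt => /predU1P[<- _|li ib].
    by rewrite nthp // -[l]/(size (x :: p)).-1 nth_last.
  rewrite nth_cat sz1 ltnNge (_ : r.-1 <= i) /=; last lia.
  rewrite -cat_cons nth_cat /= ltnNge (_ : (size p).+1 <= i - r.-1) /=; last by rewrite -/l; lia.
  have lt : i - r.-1 - (size p).+1 < size (enum (S :\ c)) by rewrite sz3 -/l; lia.
  by have := mem_nth x lt; rewrite mem_enum inE => /andP[].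
exists l, (fun i => nth x w (i : 'I__)); split.
  by move=> i j /eqP; rewrite nth_uniq ?szw // => /eqP/ord_inj.
suff adj1 (i j : 'I_(r.-1 + l + 3)) : i != j ->
    [|| (i < r) && (j < r), (r.-1 <= i < r.-1 + l) && (j == i.+1 :> nat)
      | [&& r.-1 + l <= i, r.-1 + l <= j
          & j - (r.-1 + l) == (i - (r.-1 + l)).+1 %% 3]] ->
    adj (nth x w i) (nth x w j).
  move=> i j /andP[ij /orP[]]; first exact: adj1.
  by rewrite adj_sym; apply: adj1; rewrite eq_sym.
move=> ij; have wij : nth x w i != nth x w j by rewrite nth_uniq ?szw.
case/or3P=> [/andP[ir jr]|/andP[/andP[ri ib] /eqP ->]|/and3P[bi bj _]].
- by apply: (cliqueP _ cR) => //; apply: nthR.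
- have -> : (i : nat) = r.-1 + (i - r.-1) by lia.
  rewrite -addnS !nthp; [|lia|lia].
  by move/pathP: xp => /(_ x (i - r.-1)); apply; rewrite -/l; lia.
- by apply: (cliqueP _ cS) => //; apply: nthS; rewrite ?bi ?bj ltn_ord.
Qed.

Lemma clique_core_iso (G : sgraph) (R : {set G}) j :
  clique R -> core_set G j = R -> iso (core G j) (complete #|R|).
Proof.
move=> cR coreR; pose f (i : complete #|R|) := enum_val (i : 'I_#|R|).
have f_inj : injective f by apply: enum_val_inj.
apply: (iso_induced f_inj) => [x y|].
  rewrite /= /sym_rel andbT; have [->|xy] := eqVneq x y; first by rewrite adj_irr.
  by rewrite (cliqueP _ cR) ?enum_valP // inj_eq.
rewrite coreR; apply/eqP; rewrite eqEcard card_imset // cardsT card_ord leqnn andbT.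
by apply/subsetP=> _ /imsetP[x _ ->]; apply: enum_valP.
Qed.

Lemma edgesE (G : sgraph) : #|edges G| = kcl 2 [set: G].
Proof.
apply: eq_card => S; rewrite [RHS]inE subsetT /=; apply/imsetP/andP.
  case=> -[x y] /=; rewrite inE /= => xy ->.
  have nxy : x != y by apply: contraTneq xy => ->; rewrite adj_irr.
  by rewrite clique_set2 // cards2 nxy.
case=> cS /cards2P[x [y [xy E]]]; exists (x, y); rewrite ?E // inE /=.
by move: cS; rewrite E clique_set2.
Qed.

Lemma ncliquesE s (G : sgraph) : ncliques s G = kcl s [set: G].
Proof. by apply: eq_card => S; rewrite !inE subsetT. Qed.

Theorem theorem2p2 (m n s r t : nat) (G : sgraph)
  (m_gt0 : 0 < m) (n_gt0 : 0 < n) (s_ge3 : 3 <= s)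
  (mn_ge : ('C(s, 2)%:Z - s%:Z <= m%:Z - n%:Z)%R)
  (mn_le : (m%:Z - n%:Z <= 'C(n, 2)%:Z - n%:Z)%R)
  (rtP : rt_params m n r t)
  (G_mn : in_Gmn m n G)
  (G_max : forall H : sgraph, in_Gmn m n H -> ncliques s H <= ncliques s G) :
  (t <= s - 2 -> iso (core G (s - 2)) (complete r)) /\
  (s - 1 <= t ->
     iso (core G (s - 2)) (complete_plus r t) \/
     [/\ s = 3, t = 2, 3 <= r & in_B r 3 (core G (s - 2))]).
Proof.
have binS1 a : 'C(a.+1, 2) = 'C(a, 2) + a by rewrite binS bin1.
case: s s_ge3 mn_ge G_max => [|[|[|k0]]] // _ mn_ge G_max.
set k := k0.+2 in mn_ge G_max *.
have -> : k.+1 - 2 = k.-1 by lia.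
have -> : k.+1 - 1 = k by lia.
have [G_conn eG sG] := G_mn; rewrite edgesE in eG.
have [r_gt0 t_gt0 mn_eq rt] := rtP.
have {}mn_ge : 'C(k.+1, 2) + n <= m + k.+1 by lia.
(* Hence [m >= n], which rules out the degenerate parameters [t = r = 1]. *)
have ck : k.+1 <= 'C(k.+1, 2).
  by rewrite binS1 /k !binS1; lia.
have {rt} [t2 tr] : 1 < t /\ t <= r.
  by case: rt => [[_ /andP[]]|[E _]] //; lia.
case: r r_gt0 tr mn_eq rtP => // rho _ tr mn_eq _.
have {mn_eq} mn_eq : m + 2 = n + 'C(rho, 2) + t by move: mn_eq; rewrite /=; lia.
(* If [n <= r], then [t >= 2] would force more than ['C(n, 2)] edges. So the competitor [extremal]
   fits on [n] vertices. *)
have rn : rho.+1 < n.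
  rewrite ltnNge; apply/negP=> nr.
  have := @leq_bin2l n.-1 rho 2; have := binS1 n.-1; rewrite prednK //; lia.
have kr : k <= rho.+1.
  rewrite leqNgt; apply/negP=> lt; have := @leq_bin2l rho.+2 k 2; move: mn_ge.
  rewrite !binS1; lia.
have count : 'C(rho.+1, k.+1) + 'C(t, k) <= kcl k.+1 [set: G].
  rewrite -ncliquesE; apply: leq_trans (G_max (extremal n rho.+1 t) _).
    by rewrite ncliquesE; apply: extremal_cliques.
  split; first exact: extremal_connected; last by rewrite card_ord.
  by have := extremal_edges t_gt0 tr rn; rewrite edgesE binS1; lia.
have j0 : 0 < k.-1 by [].
have via_star (R : {set G}) v : clique R -> #|R| = rho.+1 -> v \notin R ->
    t <= #|nbh R v| -> k <= t -> iso (core G k.-1) (complete_plus rho.+1 t).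
  move=> cR sR vR tN kt.
  have [f [f_inj f_hom]] := complete_plus_embedding cR vR tN.
  rewrite sR in f f_inj f_hom.
  apply: (core_iso G_conn j0 _ f_inj f_hom).
  - by rewrite card_option.
  - rewrite eG sG card_option card_ord.
    by have := complete_plus_edges tr; rewrite binS1; lia.
  - by move=> x; apply: complete_plus_deg => //; lia.
(* If [r = s - 1], the lower bound on [m - n] forces [t = r], and [count] only provides one
   [s]-clique. Removing a vertex from it gives [R], with the removed vertex joined to all of [R]. *)
have [kr'|rk] := leqP k rho; last first.
  have Er : rho.+1 = k by lia.
  have Et : t = rho.+1.
    by move: mn_ge; rewrite -Er !binS1; lia.
  split=> [|kt]; first lia.
  left; move: count; rewrite Et Er binn bin_small // add0n => /card_gt0P[S].
  rewrite inE => /and3P[_ cS /eqP sS].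
  have /card_gt0P[v vS] : 0 < #|S| by rewrite sS.
  have sR : #|S :\ v| = rho.+1 by move: sS; rewrite (cardsD1 v) vS Er => -[].
  have := @via_star (S :\ v) v; rewrite Et -Er; apply.
  - exact: sub_clique (subsetDl _ _) cS.
  - by [].
  - by rewrite !inE eqxx.
  - rewrite -[leqLHS]sR; apply/subset_leq_card/subsetP=> x xS.
    rewrite inE xS /=; move: xS => /setD1P[xv xS].
    by apply: (cliqueP _ cS) => //; rewrite eq_sym.
  - by rewrite Er.
have [R [cR sR]] : exists R : {set G}, clique R /\ #|R| = rho.+1.
  apply: (@large_clique G k rho t.-1) => //; last by rewrite prednK.
  - lia.
  - by rewrite eG sG; lia.
have R_neq0 : R != set0 by rewrite -card_gt0 sR.
have e2 : kcl 2 [set: G] + #|R| = 'C(#|R|, 2) + #|G| + t.-1.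
  by rewrite eG sG sR binS1; lia.
split=> [tk|kt].
  rewrite -sR; apply: clique_core_iso => //.
  apply/eqP; rewrite eqEsubset; apply/andP; split.
    (* The whole excess beyond [R] is [t - 1 < s - 2], too little for a core vertex outside [R]. *)
    apply: (core_sub (y := t.-1) G_conn R_neq0); first lia.
    by rewrite e2 kcl_clique.
  apply: core_set_max => v vR; rewrite /deg_in.
  have : R :\ v \subset nbh R v.
    apply/subsetP=> x /setD1P[xv xR]; rewrite inE xR /=.
    by apply: (cliqueP _ cR) => //; rewrite eq_sym.
  move/subset_leq_card; apply: leq_trans.
  by have := cardsD1 v R; rewrite vR sR; lia.
have [|||||[v vR tN]|[t1 [S [cS S3 SR]]]] := @clique_growth G k t.-1 R G_conn.
- by rewrite prednK.
- by [].
- by rewrite sR.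
- by [].
- by rewrite sR prednK.
- by left; apply: (via_star R v) => //; rewrite -[t]prednK.
(* The triangle outcome has excess [t - 1 = 1], and [k <= t] then leaves only [k = 2], that is
   [s = 3]. *)
right; have Et : t = 2 by lia.
have Ek : k0 = 0 by lia.
have R0 : 0 < #|R| by rewrite sR.
have [l [f [f_inj f_hom]]] := clique_path_cycle_embedding G_conn cR cS R0 S3 SR.
rewrite sR in f f_inj f_hom.
rewrite /k Ek; split=> //; first lia.
exists l; have r3 : 2 < rho.+1 by lia.
apply: (core_iso G_conn _ _ f_inj f_hom) => //.
- by rewrite card_ord; lia.
- rewrite eG sG card_ord; have := clique_path_cycle_edges l r3.
  by rewrite binS1 /=; lia.
- exact: clique_path_cycle_deg.
Qed.
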